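(* Fix $\alpha\in(0,1)$, $\sigma>0$, $\kappa>0$, a positive sequence $C_n\to\infty$ (used in the definition of the confusion set), dimensions $d=d_n\ge 2$ that may vary arbitrarily with $n$, and an index $r\in[d]$. For any $\tau\in\{0,1,\dots,d-2\}$ (possibly depending on $n$), suppose that the $r$-th mean gap satisfies $\mu_r-\mu_\star\ge\varepsilon=\varepsilon_n\ge C_n'\varepsilon^\star(\tau)$, where $C_n'$ is any positive sequence with $C_n'\to\infty$ and $\varepsilon^\star(\tau)=\sqrt{(1\vee\log\tau)/n}$. Let $\widehat\Theta_{\mathrm{DA}}=\{k\in[d]:\psi_k=0\}$ be the confidence set obtained by inverting the level-$\alpha$ DA argmin tests $\psi_1,\dots,\psi_d$ (with either the plug-in or the noise-adjusted selection rule). Then $$\lim_{n\to\infty}\ \inf_{P\in\mathcal{P}_{1,r}(\varepsilon;\tau)}P\bigl(r\notin\widehat\Theta_{\mathrm{DA}}\bigr)=1 .$$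
   Context: Notation: $[d]=\{1,\dots,d\}$; $\bm X_1,\dots,\bm X_{2n}$ are i.i.d. from $P$ on $\mathbb{R}^d$ with mean $\bm\mu=(\mu_1,\dots,\mu_d)^\top$; $z_{1-\alpha}$ is the $1-\alpha$ standard normal quantile; $a\vee b=\max(a,b)$, and $1\vee\log 0=1$. ''sargmin'' is the smallest index attaining the minimum. An infimum over an empty class is taken to be $1$. DA argmin test: $\overline{\bm X}^{(1)}$, $\widehat{\bm\Sigma}^{(1)}$ are the sample mean and sample covariance matrix of $\bm X_1,\dots,\bm X_n$, and $\overline{\bm X}^{(2)}$, $\widehat{\bm\Sigma}^{(2)}$ those of $\bm X_{n+1},\dots,\bm X_{2n}$. For an index $j\in[d]$ put $\bm\gamma_k=\bm e_j-\bm e_k$ and let $\widehat s$ be either $$\mathop{\mathrm{sargmin}}_{k\in[d]\setminus\{j\}}\overline X^{(2)}_k\ \text{(plug-in)}\quad\text{or}\quad \mathop{\mathrm{sargmin}}_{k\in[d]\setminus\{j\}}\frac{\overline X^{(2)}_k-\overline X^{(2)}_j}{\sqrt{\bm\gamma_k^\top\widehat{\bm\Sigma}^{(2)}\bm\gamma_k}\vee\kappa}\ \text{(noise-adjusted, }\kappa>0\text{ a fixed constant)}.$$ Then $\psi_j=1$ iff $\sqrt n\,\bm\gamma_{\widehat s}^\top\overline{\bm X}^{(1)}>z_{1-\alpha}\sqrt{\bm\gamma_{\widehat s}^\top\widehat{\bm\Sigma}^{(1)}\bm\gamma_{\widehat s}}$, else $\psi_j=0$. Let $\mu_\star=\min_{k\in[d]}\mu_k$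 and $\Theta_{-r}=\arg\min_{k\in[d]\setminus\{r\}}\mu_k$ (set of all minimizers). The confusion set is $$\mathbb{C}_r=\Bigl\{k\in[d]\setminus(\{r\}\cup\Theta_{-r}):\ \tfrac{\mu_r-\mu_\star}{2}\le\mu_k-\mu_\star\le C_n\sqrt{\tfrac{\log d}{n}}\Bigr\}.$$ $\mathcal{P}$ is the class of distributions on $\mathbb{R}^d$ that are sub-Gaussian with variance proxy $\sigma^2$: $\mathbb{E}_P[\exp(\lambda\langle\bm v,\bm X-\bm\mu\rangle)]\le\exp(\lambda^2\sigma^2/2)$ for all $\lambda\in\mathbb{R}$ and all unit vectors $\bm v$. For $\varepsilon>0$, $\mathcal{P}_{1,r}(\varepsilon;\tau)=\{P\in\mathcal{P}:\mu_r-\mu_\star\ge\varepsilon\ \text{and}\ |\mathbb{C}_r|=\tau\}$. *)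

(* Defs.v *)
From HB Require Import structures.
From mathcomp Require Import all_boot all_order all_algebra.
From mathcomp Require Import all_classical all_reals all_analysis.

Set Implicit Arguments.
Unset Strict Implicit.
Unset Printing Implicit Defensive.

Import Order.TTheory GRing.Theory Num.Theory.
Import numFieldNormedType.Exports.

Local Open Scope classical_set_scope.
Local Open Scope ring_scope.

Section iid_law.
Context (d : measure_display) (T : measurableType d) (R : realType).

Definition tuple_cons n (x : T * n.-tuple T) : n.+1.-tuple T :=
  [tuple of x.1 :: x.2].

Lemma measurable_tuple_cons n :
  measurable_fun [set: T * n.-tuple T] (@tuple_cons n).
Proof. exact: measurable_cons. Qed.

HB.instance Definition _ n :=
  isMeasurableFun.Build _ _ _ _ (@tuple_cons n) (@measurable_tuple_cons n).

(* The n-fold product measure of P on n-tuples with the product sigma-algebra,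
   i.e. the joint law of n i.i.d. draws from P. *)
Fixpoint iid_law (P : probability T R) (n : nat) : probability (n.-tuple T) R :=
  match n with
  | 0 => \d_([tuple] : 0.-tuple T)
  | m.+1 => distribution (P \x iid_law P m)%E (@tuple_cons m)
  end.

End iid_law.

Section Euclidean.
Context (R : realType) (d : nat).

Definition colv (x : d.-tuple R) : 'cV[R]_d := \col_k tnth x k.

Definition dotv (u v : 'cV[R]_d) : R := (u^T *m v) 0 0.

Definition quadv (S : 'M[R]_d) (u : 'cV[R]_d) : R := (u^T *m S *m u) 0 0.

Definition gamma (j k : 'I_d) : 'cV[R]_d := delta_mx j 0 - delta_mx k 0.

End Euclidean.

Section Argmin.
Context (R : realType) (d : nat).

Definition argmins_except (j : 'I_d) (f : 'I_d -> R) : {set 'I_d} :=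
  [set k | (k != j) && [forall l, (l != j) ==> (f k <= f l)]]%SET.

(* The default j is never returned when d >= 2. *)
Definition sargmin_except (j : 'I_d) (f : 'I_d -> R) : 'I_d :=
  odflt j [pick k in argmins_except j f |
             [forall l in argmins_except j f, (k <= l)%N]].

End Argmin.

Definition std_normal_quantile {R : realType} (p : R) : R :=
  inf [set x : R | (p%:E <= normal_prob 0 1 `]-oo, x])%E].

Section SampleMoments.
Context (R : realType) (d n : nat).
Implicit Types Y : 'I_n -> 'cV[R]_d.

Definition sample_mean Y : 'cV[R]_d := n%:R^-1 *: \sum_i Y i.

Definition sample_cov Y : 'M[R]_d :=
  n.-1%:R^-1 *: \sum_i (Y i - sample_mean Y) *m (Y i - sample_mean Y)^T.

End SampleMoments.

Inductive selection_rule := PlugIn | NoiseAdjusted.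

Section DATest.
Context (R : realType) (d n : nat).
Variables (rule : selection_rule) (kappa alpha : R).
Implicit Types (X : (n + n).-tuple (d.-tuple R)) (j k : 'I_d).

Definition half1 X (i : 'I_n) : 'cV[R]_d := colv (tnth X (lshift n i)).
Definition half2 X (i : 'I_n) : 'cV[R]_d := colv (tnth X (rshift n i)).

Definition selection_score X j k : R :=
  let m := sample_mean (half2 X) in
  let S := sample_cov (half2 X) in
  match rule with
  | PlugIn => m k 0
  | NoiseAdjusted =>
      (m k 0 - m j 0) / Num.max (Num.sqrt (quadv S (gamma R j k))) kappa
  end.

Definition selected X j : 'I_d := sargmin_except j (selection_score X j).

Definition DA_test X j : bool :=
  let g := gamma R j (selected X j) in
  std_normal_quantile (1 - alpha) * Num.sqrt (quadv (sample_cov (half1 X)) g)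
  < Num.sqrt n%:R * dotv g (sample_mean (half1 X)).

Definition DA_confidence_set X : {set 'I_d} :=
  [set k | ~~ DA_test X k]%SET.

End DATest.

Section Classes.
Context (R : realType) (d : nat).
Implicit Types (P : probability (d.-tuple R) R) (mu : 'cV[R]_d) (r : 'I_d).

Definition mean P : 'cV[R]_d := \col_k fine 'E_P[fun x => tnth x k]%E.

(* The minimum over all entries of mu; the seed mu r is one of them. *)
Definition min_mean mu r : R := \big[Num.min/mu r 0]_k mu k 0.

Definition confusion_set (Cn : R) (n : nat) mu r : {set 'I_d} :=
  [set k | [&& k != r, k \notin argmins_except r (fun l => mu l 0),
               (mu r 0 - min_mean mu r) / 2 <= mu k 0 - min_mean mu r &
               mu k 0 - min_mean mu r <= Cn * Num.sqrt (ln d%:R / n%:R)]]%SET.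

(* Integrability makes the mean vector exist; it follows from the exponential
   moment bound. *)
Definition sub_gaussian (sigma : R) P : Prop :=
  (forall k, P.-integrable setT (fun x => (tnth x k)%:E)) /\
  (forall (lambda : R) (v : 'cV[R]_d), dotv v v = 1 ->
    ('E_P[fun x => expR (lambda * dotv v (colv x - mean P))]
       <= (expR (lambda ^+ 2 * sigma ^+ 2 / 2))%:E)%E).

Definition alternatives (sigma Cn : R) (n : nat) r (eps : R) (tau : nat) :
    set (probability (d.-tuple R) R) :=
  [set P | [/\ sub_gaussian sigma P,
               eps <= mean P r 0 - min_mean (mean P) r &
               #|confusion_set Cn n (mean P) r| = tau]].

End Classes.

(* ln 0 = 0, so that tau = 0 gives the value sqrt (1 / n). *)
Definition eps_star {R : realType} (tau n : nat) : R :=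
  Num.sqrt (Num.max 1 (ln tau%:R) / n%:R).

(* Infimum of a set of probabilities, equal to 1 on the empty set. *)
Definition prob_inf {R : realType} (S : set (\bar R)) : \bar R :=
  if S == set0 then 1%E else ereal_inf S.

(* Main.v *)
(** The selection step only looks at the second half of the sample, so after
    conditioning on it (Tonelli) the test statistic is a fixed contrast
    [gamma_s] of the first half.  Write [Delta = mu_r - mu_star].  A contrast of
    two coordinates has a moment generating function bounded by
    [exp (l^2 sigma^2)], hence Chernoff tails for its mean and, by Markov, a
    bounded sample variance with high probability.

    Let [k*] attain the minimum, [M] bound its estimated noise level and
    [c = min kappa 1 / (4 M)].  Comparing the scores of [k*] and of the selected
    index [s] forces the empirical contrast of [s] to be at least [2 c Delta],
    for both rules.  An index with [mu_r - mu_k <= c Delta] reaches this level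
    only through a deviation of size [c Delta] if it lies in the confusion set
    ([tau] such indices, paid for by [C'_n]), and of size
    [c C_n sqrt (log d / n) / 2] otherwise (at most [d] indices, paid for by
    [C_n]).  So [mu_r - mu_s > c Delta] with high probability, and
    [sqrt n (mu_r - mu_s)] then dominates the [O(1)] noise of the test. *)
Require Import Defs.
From mathcomp Require Import all_boot all_order all_algebra.
From mathcomp Require Import all_classical all_reals all_analysis.
From mathcomp Require Import measurable_realfun ring lra.
Import Order.TTheory GRing.Theory Num.Theory.
Import numFieldNormedType.Exports.
Set Implicit Arguments.
Unset Strict Implicit.
Unset Printing Implicit Defensive.
Local Open Scope classical_set_scope.
Local Open Scope ring_scope.

(** * Integrals against the law of an i.i.d. sample *)

Section iid_integral.
Context (d : measure_display) (T : measurableType d) (R : realType).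
Variable P : probability T R.
Local Open Scope ereal_scope.

Lemma integral_iid_lawS n (f : n.+1.-tuple T -> \bar R) :
  measurable_fun [set: n.+1.-tuple T] f -> (forall z, 0 <= f z) ->
  \int[iid_law P n.+1]_z f z =
  \int[P]_x \int[iid_law P n]_y f (tuple_cons (x, y)).
Proof.
move=> mf f0; rewrite /= ge0_integral_distribution//.
rewrite fubini_tonelli1//; last by move=> x; exact: f0.
exact: (measurableT_comp mf (@measurable_tuple_cons _ T n)).
Qed.

Lemma measurable_tuple_cat m n :
  measurable_fun [set: m.-tuple T * n.-tuple T]
    (fun p : m.-tuple T * n.-tuple T => [tuple of p.1 ++ p.2]).
Proof.
apply/measurable_fun_tnthP => i.
case: (split_ordP i) => j ->.
- rewrite (_ : _ \o _ = (@tnth m T ^~ j) \o fst).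
    by apply: measurableT_comp => //; exact: measurable_tnth.
  by apply/funext => p /=; rewrite tnth_lshift.
- rewrite (_ : _ \o _ = (@tnth n T ^~ j) \o snd).
    by apply: measurableT_comp => //; exact: measurable_tnth.
  by apply/funext => p /=; rewrite tnth_rshift.
Qed.

Lemma measurable_tuple_cons2 n (x : T) :
  measurable_fun [set: n.-tuple T] (fun y => tuple_cons (x, y)).
Proof.
exact: (measurableT_comp (@measurable_tuple_cons _ T n) (pair1_measurable x)).
Qed.

Lemma measurable_tuple_cat1 m n (y : n.-tuple T) :
  measurable_fun [set: m.-tuple T] (fun x => [tuple of x ++ y]).
Proof.
exact: (measurableT_comp (@measurable_tuple_cat m n) (pair2_measurable y)).
Qed.

(** Induction on [m]: peel off the first draw, apply the induction hypothesis to the remaining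
    [m + n], then exchange the integral over the peeled draw with the one over the second block by
    Tonelli. *)
Lemma integral_iid_law_cat m n (f : (m + n).-tuple T -> \bar R) :
  measurable_fun [set: (m + n).-tuple T] f -> (forall z, 0 <= f z) ->
  \int[iid_law P (m + n)]_z f z =
  \int[iid_law P n]_y \int[iid_law P m]_x f [tuple of x ++ y].
Proof.
elim: m f => [|m IH] f mf f0.
  apply: (@eq_integral _ _ _ (iid_law P n)) => y _.
  have mfy : measurable_fun [set: 0.-tuple T] (fun x : 0.-tuple T => f [tuple of x ++ y]).
    exact: (measurableT_comp mf (@measurable_tuple_cat1 0 n y)).
  rewrite /= integral_dirac// diracT mul1e; congr f.
  exact: val_inj.
have mfc x : measurable_fun [set: (m + n).-tuple T] (fun y => f (tuple_cons (x, y))).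
  exact: (measurableT_comp mf (@measurable_tuple_cons2 _ _)).
rewrite integral_iid_lawS//.
under eq_integral do rewrite IH//.
have mF : measurable_fun [set: T * (m.-tuple T * n.-tuple T)]
    (fun q : T * (m.-tuple T * n.-tuple T) =>
    f (tuple_cons (q.1, [tuple of q.2.1 ++ q.2.2]))).
  apply: (measurableT_comp mf).
  apply: (measurableT_comp (@measurable_tuple_cons _ T (m + n))
    (g := fun q : T * (m.-tuple T * n.-tuple T) =>
      (q.1, [tuple of q.2.1 ++ q.2.2]))).
  apply: measurable_fun_pair => //.
  exact: (measurableT_comp (@measurable_tuple_cat m n)).
(* The other [m] draws of the first block are integrated out in [h]; the exchange requires its joint
   measurability in the peeled draw and the second block. *)
pose h (p : T * n.-tuple T) :=
  \int[iid_law P m]_x f (tuple_cons (p.1, [tuple of x ++ p.2])).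
have mh : measurable_fun [set: T * n.-tuple T] h.
  apply: (@measurable_fun_fubini_tonelli_F _ _ _ _ _ (iid_law P m)
    (fun q : (T * n.-tuple T) * m.-tuple T =>
      f (tuple_cons (q.1.1, [tuple of q.2 ++ q.1.2])))) => //.
  rewrite (_ : (fun _ => _) = (fun q : T * (m.-tuple T * n.-tuple T) =>
    f (tuple_cons (q.1, [tuple of q.2.1 ++ q.2.2]))) \o
    (fun q : (T * n.-tuple T) * m.-tuple T => (q.1.1, (q.2, q.1.2))))//.
  apply: measurableT_comp mF _; apply: measurable_fun_pair => /=.
    exact: measurableT_comp.
  by apply: measurable_fun_pair => //=; exact: measurableT_comp.
rewrite (fubini_tonelli h) => //; last first.
  by move=> p; exact: integral_ge0.
apply: eq_integral => y _; rewrite /h/=.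
rewrite integral_iid_lawS//; last first.
  exact: (measurableT_comp mf (@measurable_tuple_cat1 _ _ _)).
apply: eq_integral => x _; apply: eq_integral => w _; congr f.
exact: val_inj.
Qed.

(** This is the conditioning step. Given the second block [y], the probability of [E] is at most 1
    when [y] is in [B] and at most [p] otherwise; integrating over [y] gives the bound. *)
Lemma iid_law_cat_le m n (E : set ((m + n).-tuple T)) (B : set (n.-tuple T))
    (p : R) :
  measurable E -> measurable B -> (0 <= p)%R ->
  (forall y, ~ B y ->
     iid_law P m [set x : m.-tuple T | E [tuple of x ++ y]] <= p%:E) ->
  iid_law P (m + n) E <= iid_law P n B + p%:E.
Proof.
move=> mE mB p0 H.
rewrite -(setIT E) -(@integral_indic _ _ _ (iid_law P (m + n)) _ measurableT)//.
rewrite integral_iid_law_cat//; last exact/measurable_EFinP.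
have mEy (y : n.-tuple T) : measurable [set x : m.-tuple T | E [tuple of x ++ y]].
  rewrite -(setTI [set _ | _]).
  exact: (@measurable_tuple_cat1 m n y).
apply: (@le_trans _ _ (\int[iid_law P n]_y ((\1_B y)%:E + p%:E))); last first.
  rewrite ge0_integralD//; last exact/measurable_EFinP.
  rewrite integral_indic// setIT integral_cst//.
  by rewrite [X in _ * X]probability_setT mule1.
apply: ge0_le_integral => //.
- by move=> y _; exact: integral_ge0.
- apply: (@measurable_fun_fubini_tonelli_G _ _ _ _ _ (iid_law P m)
    (fun q : m.-tuple T * n.-tuple T =>
      (\1_E [tuple of q.1 ++ q.2])%:E)) => //=.
  have mI : measurable_fun [set: (m + n).-tuple T] (\1_E : _ -> R) by [].
  apply/measurable_EFinP; apply: (measurableT_comp mI).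
  exact: measurable_tuple_cat.
- by apply/measurable_EFinP; exact: measurable_funD.
move=> y _.
rewrite (_ : \int[_]_x _ =
    iid_law P m [set x : m.-tuple T | E [tuple of x ++ y]]); last first.
  by rewrite -[in RHS](setIT [set _ | _]) -integral_indic.
have [By|nBy] := pselect (B y).
  rewrite indicE mem_set//= (le_trans (probability_le1 _ _))//.
  by rewrite -EFinD lee_fin lerDl.
by rewrite indicE memNset//= add0e; exact: H.
Qed.

Lemma measurable_sum_tnth n (h : T -> R) : measurable_fun setT h ->
  measurable_fun [set: n.-tuple T] (fun y : n.-tuple T => \sum_i h (tnth y i))%R.
Proof.
move=> mh; apply: measurable_sum => i.
by apply: measurableT_comp => //; exact: measurable_tnth.
Qed.

Lemma integral_iid_law_sum n (h : T -> R) (K : R) :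
  measurable_fun setT h -> (forall x, 0 <= h x)%R ->
  \int[P]_x (h x)%:E <= K%:E ->
  \int[iid_law P n]_y (\sum_i h (tnth y i))%:E <= (n%:R * K)%:E.
Proof.
move=> mh h0 hK; elim: n => [|n IH].
  under eq_integral do rewrite big_ord0.
  by rewrite integral0 mul0r.
have mS := @measurable_sum_tnth n _ mh.
have S0 (y : n.-tuple T) : (0 <= \sum_i h (tnth y i))%R by exact: sumr_ge0.
rewrite integral_iid_lawS; last 2 first.
- by apply/measurable_EFinP; exact: measurable_sum_tnth.
- by move=> z; rewrite lee_fin sumr_ge0.
have eqS x : \int[iid_law P n]_y
    (\sum_i h (tnth (tuple_cons (x, y)) i))%:E =
    (h x)%:E + \int[iid_law P n]_y (\sum_i h (tnth y i))%:E.
  under eq_integral.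
    move=> y _; rewrite big_ord_recl tnth0.
    under eq_bigr do rewrite tnthS.
    rewrite EFinD; over.
  rewrite /= ge0_integralD//.
  - by rewrite integral_cst// [X in _ * X]probability_setT mule1.
  - by move=> y _; rewrite lee_fin.
  - by move=> y _; rewrite lee_fin.
  - exact/measurable_EFinP.
under eq_integral do rewrite eqS.
rewrite ge0_integralD//; last 3 first.
- by move=> x _; rewrite lee_fin.
- exact/measurable_EFinP.
- by move=> x _; apply: integral_ge0 => y _; rewrite lee_fin.
rewrite integral_cst// [X in _ * X]probability_setT mule1.
by rewrite -natr1 mulrDl mul1r addrC EFinD leeD.
Qed.

Lemma integral_iid_law_expR n (g : T -> R) (e : R) :
  measurable_fun setT g -> \int[P]_x (expR (g x))%:E <= e%:E ->
  \int[iid_law P n]_y (expR (\sum_i g (tnth y i)))%:E <= (e ^+ n)%:E.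
Proof.
move=> mg ge; elim: n => [|n IH].
  under eq_integral do rewrite big_ord0 expR0.
  by rewrite integral_cst// [X in _ * X]probability_setT mule1.
have mS := @measurable_sum_tnth n _ mg.
have mE k : measurable_fun [set: k.-tuple T]
    (fun y : k.-tuple T => (expR (\sum_i g (tnth y i)))%:E).
  apply/measurable_EFinP.
  exact: (measurableT_comp (@measurable_expR R) (@measurable_sum_tnth k _ mg)).
rewrite integral_iid_lawS//.
have eqS x : \int[iid_law P n]_y
    (expR (\sum_i g (tnth (tuple_cons (x, y)) i)))%:E =
    (expR (g x))%:E * \int[iid_law P n]_y (expR (\sum_i g (tnth y i)))%:E.
  under eq_integral.
    move=> y _; rewrite big_ord_recl tnth0.
    under eq_bigr do rewrite tnthS.
    rewrite expRD EFinM; over.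
  by rewrite /= ge0_integralZl//; exact: mE.
under eq_integral do rewrite eqS.
have int_ge0 d' (T' : measurableType d') (Q : probability T' R) (h : T' -> R) :
    0 <= \int[Q]_x (expR (h x))%:E.
  by apply: integral_ge0 => x _; rewrite lee_fin expR_ge0.
rewrite ge0_integralZr//; last first.
  by apply/measurable_EFinP; exact: measurableT_comp.
by rewrite exprS EFinM; apply: lee_pmul => //; exact: int_ge0.
Qed.

End iid_integral.

(** * Tail bounds for i.i.d. sums *)

Lemma markov_le (d : measure_display) (T : measurableType d) (R : realType)
    (P : probability T R) (h : T -> R) (a K : R) :
  measurable_fun setT h -> (forall x, 0 <= h x) -> 0 < a ->
  (\int[P]_x (h x)%:E <= K%:E)%E ->
  (P [set x | (a <= h x)%R] <= (K / a)%:E)%E.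
Proof.
move=> mh h0 a0 hK.
have := @le_integral_abse _ _ _ P _ measurableT (EFin \o h) a.
rewrite setTI => /(_ _ a0)/=.
have -> : [set x | (a%:E <= `|(h x)%:E|)%E] = [set x | a <= h x].
  by apply/seteqP; split=> x /=; rewrite lee_fin ger0_norm.
under eq_integral do rewrite ger0_norm//.
move=> /(_ _)/le_trans/(_ hK) H.
rewrite EFinM lee_pdivlMr// muleC; apply: H.
exact/measurable_EFinP.
Qed.

Section tail_bounds.
Context (d : measure_display) (T : measurableType d) (R : realType).
Implicit Types (P : probability T R) (g : T -> R).

(* The exponent lacks the usual 1/2 because a contrast of two coordinates has
   variance proxy [2 sigma^2]. *)
Definition mgf_bounded P g (s : R) :=
  forall l : R, (\int[P]_x (expR (l * g x))%:E <= (expR (l ^+ 2 * s ^+ 2))%:E)%E.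

Lemma mgf_boundedN P g s : mgf_bounded P g s -> mgf_bounded P (fun x => - g x) s.
Proof.
move=> H l; have := H (- l); rewrite sqrrN.
by under eq_integral do rewrite mulNr -mulrN.
Qed.

Lemma iid_law_chernoff P n g (s t : R) :
  measurable_fun setT g -> 0 < s -> 0 <= t -> mgf_bounded P g s ->
  (iid_law P n [set y | (n%:R * t <= \sum_i g (tnth y i))%R]
     <= (expR (- (n%:R * t ^+ 2 / (4 * s ^+ 2))))%:E)%E.
Proof.
move=> mg s0 t0 H.
(* At [t = 0] the bound is 1, while the Chernoff parameter below would vanish and could not be
   cancelled. *)
have [->|tn0] := eqVneq t 0.
  rewrite expr0n/= mulr0 mul0r oppr0 expR0 probability_le1//.
  rewrite -[X in measurable X]setTI; apply: measurable_fun_le => //.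
  exact: measurable_sum_tnth.
have {}t0 : 0 < t by rewrite lt0r tn0.
have s20 : 0 < s ^+ 2 by rewrite exprn_gt0.
(* This is the maximizer of [l * t - l ^+ 2 * s ^+ 2], whose maximum is [t ^+ 2 / (4 * s ^+ 2)]. *)
pose l := t / (2 * s ^+ 2).
have l0 : 0 < l by rewrite divr_gt0// mulr_gt0.
have mlg : measurable_fun setT (fun x => l * g x).
  exact: measurable_funM.
have := integral_iid_law_expR n mlg (H l).
have mS : measurable_fun [set: n.-tuple T]
    (fun y : n.-tuple T => expR (\sum_i l * g (tnth y i))).
  exact: (measurableT_comp (@measurable_expR R)
    (@measurable_sum_tnth _ _ _ n _ mlg)).
have e0 (y : n.-tuple T) : 0 <= expR (\sum_i l * g (tnth y i)) by exact: expR_ge0.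
move=> /(markov_le mS e0 (expR_gt0 (l * (n%:R * t)))).
rewrite (_ : [set y | _] = [set y | (n%:R * t <= \sum_i g (tnth y i))%R]); last first.
  apply/seteqP; split=> y /=;
    by rewrite -mulr_sumr ler_expR ler_pM2l.
move=> /le_trans; apply; rewrite lee_fin -expRM_natl -expRN -expRD ler_expR.
rewrite (_ : _ + _ = - (n%:R * t ^+ 2 / (4 * s ^+ 2)))//.
by rewrite /l; field; rewrite lt0r_neq0.
Qed.

(** For [u >= 0], squaring [expR (u / 2) >= 1 + u / 2] already gives [expR u >= u ^+ 2 / 4]. The
    symmetric form reads a second moment off the exponential moments at 1 and -1. *)
Lemma sqr_le_expR (u : R) : u ^+ 2 <= 4 * (expR u + expR (- u)).
Proof.
wlog u0 : u / 0 <= u.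
  move=> H; have [/H//|/ltW u0] := leP 0 u.
  by have := H (- u); rewrite oppr_ge0 sqrrN opprK addrC; exact.
have h1 : 1 + u / 2 <= expR (u / 2) by exact: expR_ge1Dx.
have -> : expR u = expR (u / 2) ^+ 2.
  by rewrite -expRM_natl; congr expR; field.
have := expR_ge0 (- u).
nra.
Qed.

Lemma integral_sqr_le P g (s : R) : measurable_fun setT g -> mgf_bounded P g s ->
  (\int[P]_x ((g x) ^+ 2)%:E <= (8 * expR (s ^+ 2))%:E)%E.
Proof.
move=> mg H.
have H1 := H 1; have H2 := H (- 1).
rewrite !(sqrrN, expr1n, mul1r) in H1 H2.
have {}H1 : (\int[P]_x (expR (g x))%:E <= (expR (s ^+ 2))%:E)%E.
  by move: H1; under eq_integral do rewrite mul1r.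
have {}H2 : (\int[P]_x (expR (- g x))%:E <= (expR (s ^+ 2))%:E)%E.
  by move: H2; under eq_integral do rewrite mulN1r.
have m1 : measurable_fun setT (fun x => expR (g x)) by exact: measurableT_comp.
have m2 : measurable_fun setT (fun x => expR (- g x)).
  by apply: measurableT_comp => //; exact: measurableT_comp.
apply: (@le_trans _ _ (\int[P]_x (4%:E * ((expR (g x))%:E + (expR (- g x))%:E)))%E).
  apply: ge0_le_integral => //.
  - by move=> x _; rewrite lee_fin sqr_ge0.
  - by apply/measurable_EFinP; exact: measurable_funX.
  - apply/measurable_EFinP; apply: measurable_funM => //.
    exact: measurable_funD.
  - by move=> x _; rewrite -EFinD -EFinM lee_fin sqr_le_expR.
rewrite ge0_integralZl//; last 2 first.
- by apply: emeasurable_funD; exact/measurable_EFinP.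
- by move=> x _; rewrite adde_ge0// lee_fin expR_ge0.
rewrite ge0_integralD//; last 2 first.
- exact/measurable_EFinP.
- exact/measurable_EFinP.
rewrite (_ : 8 * _ = 4 * (expR (s ^+ 2) + expR (s ^+ 2))); last by ring.
by rewrite EFinM lee_pmul2l// EFinD leeD.
Qed.

(** Markov's inequality gives only a [1 / t] tail. That suffices because variances are controlled at
    one fixed index at a time, never through a union over all coordinates. *)
Lemma iid_law_sum_sqr P n g (s t : R) :
  (0 < n)%N -> measurable_fun setT g -> 0 < t -> mgf_bounded P g s ->
  (iid_law P n [set y | (n%:R * t <= \sum_i g (tnth y i) ^+ 2)%R]
     <= (8 * expR (s ^+ 2) / t)%:E)%E.
Proof.
move=> n0 mg t0 H.
have mg2 : measurable_fun setT (fun x => g x ^+ 2) by exact: measurable_funX.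
have n0' : 0 < n%:R :> R by rewrite ltr0n.
have mS := @measurable_sum_tnth _ _ _ n _ mg2.
have S0 (y : n.-tuple T) : 0 <= \sum_i g (tnth y i) ^+ 2.
  by apply: sumr_ge0 => i _; exact: sqr_ge0.
have := integral_iid_law_sum n mg2 (fun x => sqr_ge0 _) (integral_sqr_le mg H).
move=> /(markov_le mS S0 (mulr_gt0 n0' t0)) /le_trans; apply.
rewrite lee_fin (_ : _ / (_ * _) = 8 * expR (s ^+ 2) / t)//.
by field; rewrite !lt0r_neq0.
Qed.

End tail_bounds.

(** * Sample contrasts and the selected index *)

Section sargmin.
Context (R : realType) (d : nat).

Lemma sargmin_exceptP (j : 'I_d) (f : 'I_d -> R) : (1 < d)%N ->
  sargmin_except j f != j /\
  forall l, l != j -> f (sargmin_except j f) <= f l.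
Proof.
move=> d1.
suff H : sargmin_except j f \in argmins_except j f.
  move: H; rewrite inE => /andP[-> /forallP H]; split=> // l lj.
  by have /implyP := H l; exact.
rewrite /sargmin_except; case: pickP => [k /andP[]//|no].
(* Since [d >= 2], one of the indices 0 and 1 differs from [j], so minimizers exist and the default
   of [odflt] is not reached. *)
have [l0 l0j] : exists l, l != j.
  have [j0|jn0] := eqVneq (val j) 0%N.
    by exists (Ordinal d1); rewrite -val_eqE/= j0.
  by exists (Ordinal (ltnW d1)); rewrite -val_eqE eq_sym.
case: (@arg_minP _ _ _ l0 (fun l => l != j) f l0j) => k kj kmin.
have kA : k \in argmins_except j f.
  by rewrite inE kj/=; apply/forallP => l; apply/implyP; exact: kmin.
case: (@arg_minnP _ k (fun l => l \in argmins_except j f) val kA) => i iA imin.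
by have := no i; rewrite /= iA/= => /negbT/negP[]; apply/forallP => l;
  apply/implyP; exact: imin.
Qed.

End sargmin.

Section sample_moments.
Context (R : realType) (d n : nat).
Implicit Types (Y : 'I_n -> 'cV[R]_d) (r k : 'I_d).

Definition contrast Y r k (i : 'I_n) : R := Y i r 0 - Y i k 0.

Definition mean_contrast Y r k : R := n%:R^-1 * \sum_i contrast Y r k i.

Lemma dotv_gamma r k (u : 'cV[R]_d) : dotv (gamma R r k) u = u r 0 - u k 0.
Proof.
rewrite /dotv /gamma linearB/= mulmxBl mxE [X in _ + X]mxE.
by rewrite !trmx_delta -!rowE !mxE.
Qed.

Lemma sample_meanE Y k : sample_mean Y k 0 = n%:R^-1 * \sum_i Y i k 0.
Proof. by rewrite mxE summxE. Qed.

Lemma mean_contrastE Y r k :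
  mean_contrast Y r k = sample_mean Y r 0 - sample_mean Y k 0.
Proof. by rewrite !sample_meanE -mulrBr -sumrB. Qed.

Lemma quadv_sample_cov Y (u : 'cV[R]_d) :
  quadv (sample_cov Y) u =
  n.-1%:R^-1 * \sum_i dotv u (Y i - sample_mean Y) ^+ 2.
Proof.
rewrite /quadv /sample_cov -scalemxAr -scalemxAl mxE; congr (_ * _).
rewrite mulmx_sumr mulmx_suml summxE; apply: eq_bigr => i _.
rewrite (mulmxA u^T) -(mulmxA _ _ u) mxE big_ord1 expr2; congr (_ * _).
by rewrite /dotv -[in RHS](trmxK (u^T *m _)) trmx_mul trmxK [RHS]mxE.
Qed.

Lemma quadv_sample_cov_gamma Y r k :
  quadv (sample_cov Y) (gamma R r k) =
  n.-1%:R^-1 * \sum_i (contrast Y r k i - mean_contrast Y r k) ^+ 2.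
Proof.
rewrite quadv_sample_cov; congr (_ * _); apply: eq_bigr => i _.
by rewrite dotv_gamma mean_contrastE /contrast ![(_ - _ : 'cV_d) _ _]mxE
  ![(- _ : 'cV_d) _ _]mxE; congr (_ ^+ 2); ring.
Qed.

(** The sum of squares about a point is smallest at the sample mean, so any centre [a], in
    particular the population contrast, gives an upper bound. The factor 2 comes from
    [1 / (n - 1) <= 2 / n] for [n >= 2]. *)
Lemma quadv_sample_cov_le Y r k (a : R) : (1 < n)%N ->
  quadv (sample_cov Y) (gamma R r k) <=
  2 / n%:R * \sum_i (contrast Y r k i - a) ^+ 2.
Proof.
move=> n1; rewrite quadv_sample_cov_gamma.
have n0 : 0 < n%:R :> R by rewrite ltr0n ltnW.
have S0 : 0 <= \sum_i (contrast Y r k i - a) ^+ 2.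
  by apply: sumr_ge0 => i _; exact: sqr_ge0.
have n2 : 2 <= n%:R :> R by rewrite ler_nat.
have n1E : n.-1%:R = n%:R - 1 :> R.
  by rewrite -subn1 natrB// ltnW.
have le1 : n.-1%:R^-1 <= 2 / n%:R :> R.
  by rewrite n1E ler_pdivlMr// ler_pdivrMl; lra.
apply: le_trans (ler_wpM2r S0 le1); apply: ler_wpM2l.
  by rewrite invr_ge0.
set m := mean_contrast Y r k.
have Sm : \sum_i contrast Y r k i = n%:R * m.
  by rewrite /m /mean_contrast mulrA divff ?mul1r// lt0r_neq0.
rewrite -subr_ge0 -sumrB.
rewrite (_ : \sum_i _ = n%:R * (m - a) ^+ 2); first by rewrite mulr_ge0 ?sqr_ge0 ?ltW.
rewrite (eq_bigr (fun i => 2 * (m - a) * contrast Y r k i + (a ^+ 2 - m ^+ 2))).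
  by rewrite big_split/= -mulr_sumr Sm sumr_const card_ord -mulr_natl; ring.
by move=> i _; ring.
Qed.

End sample_moments.

(** * Empirical contrast of the selected index, for both selection rules *)

Section selection.
Context (R : realType) (d n : nat).
Implicit Types (X : (n + n).-tuple (d.-tuple R)).
Variables (rule : selection_rule) (kappa : R).

(** For the plug-in rule the selected contrast is at least that of [ks], and the factor is at most
    1. For the noise-adjusted rule, the contrast of [ks] over its noise level is at least
    [D / (2 * M)], and the noise level of the selected index is at least [kappa]. *)
Lemma selected_mean_contrast X (r ks : 'I_d) (M D : R) :
  (1 < d)%N -> 0 < kappa -> kappa <= M -> 1 <= M -> 0 < D -> ks != r ->
  D / 2 <= mean_contrast (half2 X) r ks ->
  quadv (sample_cov (half2 X)) (gamma R r ks) <= M ^+ 2 ->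
  Num.min kappa 1 / (2 * M) * D <=
  mean_contrast (half2 X) r (selected rule kappa X r).
Proof.
move=> d1 k0 kM M1 D0 ksr Dks Qks.
have M0 : 0 < M by lra.
have [_ /(_ ks ksr)] := sargmin_exceptP r (selection_score rule kappa X r) d1.
rewrite -/(selected rule kappa X r); set s := selected _ _ _ _.
have c0 : 0 < Num.min kappa 1 by rewrite lt_min k0 ltr01.
have c1 : Num.min kappa 1 <= 1 by rewrite ge_min lexx orbT.
have ck : Num.min kappa 1 <= kappa by rewrite ge_min lexx.
set c := Num.min kappa 1 in c0 c1 ck *.
have -> : c / (2 * M) * D = c * (D / (2 * M)) by field; rewrite lt0r_neq0.
have DM : D / (2 * M) * M = D / 2 by field; rewrite lt0r_neq0.
have DM0 : 0 < D / (2 * M) by rewrite divr_gt0// mulr_gt0.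
rewrite /selection_score; case: rule => [|] H.
  rewrite mean_contrastE in Dks; rewrite mean_contrastE.
  by nra.
move: H; rewrite -[_ s 0 - _]opprB -[_ ks 0 - _]opprB -!mean_contrastE.
rewrite !mulNr lerN2.
set w1 := Num.max _ _; set w2 := Num.max _ _.
have w1M : w1 <= M.
  by rewrite /w1 ge_max kM andbT -(ger0_norm (ltW M0)) -sqrtr_sqr ler_wsqrtr.
have w1k : kappa <= w1 by rewrite /w1 le_max lexx orbT.
have w2k : kappa <= w2 by rewrite /w2 le_max lexx orbT.
rewrite ler_pdivlMr; last by lra.
apply: le_trans.
have : D / (2 * M) <= mean_contrast (half2 X) r ks / w1.
  rewrite ler_pdivlMr; last by lra.
  nra.
nra.
Qed.

End selection.

(** * Measurability of the test *)

Section measurable_selection.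
Context (disp : measure_display) (T : measurableType disp) (R : realType).

(** The event is a finite union, over the truth tables accepted by [G], of finite intersections of
    measurable sets. *)
Lemma measurable_finite_test (I : finType) (h : I -> T -> bool)
    (G : {ffun I -> bool} -> bool) :
  (forall i, measurable_fun setT (h i)) ->
  measurable [set x | G [ffun i => h i x]].
Proof.
move=> mh.
rewrite (_ : [set x | _] =
  \bigcup_(b in [set b : {ffun I -> bool} | G b])
    \bigcap_(i in [set: I]) (h i @^-1` [set b i])).
  apply: fin_bigcup_measurable => [|b _]; first exact: finite_finset.
  apply: fin_bigcap_measurable => [|i _]; first exact: finite_finset.
  by rewrite -[X in measurable X]setTI; exact: mh.
apply/seteqP; split=> x /=.
  by move=> Gx; exists [ffun i => h i x] => //= i _; rewrite /= ffunE.
move=> [b Gb bE]; suff -> : [ffun i => h i x] = b by [].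
by apply/ffunP => i; rewrite ffunE; exact: bE.
Qed.

(** The smallest minimizer depends on [f] only through the finite table of comparisons between its
    values. *)
Lemma measurable_sargmin_except (d : nat) (j k : 'I_d) (f : T -> 'I_d -> R) :
  (forall l m, measurable_fun setT (fun x => f x l <= f x m)) ->
  measurable [set x | sargmin_except j (f x) = k].
Proof.
move=> mf.
pose A (b : {ffun 'I_d * 'I_d -> bool}) : {set 'I_d} :=
  [set l | (l != j) && [forall m, (m != j) ==> b (l, m)]]%SET.
pose G b := odflt j [pick l in A b | [forall m in A b, (l <= m)%N]] == k.
have := @measurable_finite_test _ (fun p x => f x p.1 <= f x p.2) G
  (fun p => mf p.1 p.2).
congr (measurable _); apply/seteqP.
have AE x : A [ffun p => f x p.1 <= f x p.2] = argmins_except j (f x).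
  by apply/setP => l; rewrite !inE; under eq_forallb do rewrite ffunE.
by split=> x /=; rewrite /G AE => /eqP.
Qed.

End measurable_selection.

Section measurable_moments.
Context (R : realType) (d n N : nat) (e : 'I_n -> 'I_N).
Implicit Types (r k : 'I_d).
(** The index map [e] is later [lshift], [rshift] or [id], which covers both halves of the sample as
    well as a single block. *)
Let Y (X : N.-tuple (d.-tuple R)) i : 'cV[R]_d := colv (tnth X (e i)).

Lemma measurable_tnth_tnth i k :
  measurable_fun [set: N.-tuple (d.-tuple R)] (fun X => Y X i k 0).
Proof.
rewrite (_ : (fun _ => _) = (@tnth d R ^~ k) \o (@tnth N (d.-tuple R) ^~ (e i))).
  by apply: measurableT_comp; exact: measurable_tnth.
by apply/funext => X; rewrite /Y /colv mxE.
Qed.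

Lemma measurable_contrast r k i :
  measurable_fun [set: N.-tuple (d.-tuple R)] (fun X => contrast (Y X) r k i).
Proof. by apply: measurable_funB; exact: measurable_tnth_tnth. Qed.

Lemma measurable_sample_mean k :
  measurable_fun [set: N.-tuple (d.-tuple R)] (fun X => sample_mean (Y X) k 0).
Proof.
under eq_fun do rewrite sample_meanE.
apply: measurable_funM => //; apply: measurable_sum => i.
exact: measurable_tnth_tnth.
Qed.

Lemma measurable_mean_contrast r k :
  measurable_fun [set: N.-tuple (d.-tuple R)] (fun X => mean_contrast (Y X) r k).
Proof.
apply: measurable_funM => //; apply: measurable_sum => i.
exact: measurable_contrast.
Qed.

Lemma measurable_quadv r k :
  measurable_fun [set: N.-tuple (d.-tuple R)]
    (fun X => quadv (sample_cov (Y X)) (gamma R r k)).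
Proof.
under eq_fun do rewrite quadv_sample_cov_gamma.
apply: measurable_funM => //; apply: measurable_sum => i.
apply: measurable_funX; apply: measurable_funB.
  exact: measurable_contrast.
exact: measurable_mean_contrast.
Qed.

Lemma measurable_sqrt_quadv r k :
  measurable_fun [set: N.-tuple (d.-tuple R)]
    (fun X => Num.sqrt (quadv (sample_cov (Y X)) (gamma R r k))).
Proof.
apply: (measurableT_comp (f := @Num.sqrt R)).
  by apply: continuous_measurable_fun; exact: sqrt_continuous.
exact: measurable_quadv.
Qed.

End measurable_moments.

Section measurable_test.
Context (R : realType) (d n : nat) (rule : selection_rule) (kappa alpha : R).
Hypothesis kappa0 : 0 < kappa.

Lemma measurable_selected (j k : 'I_d) :
  measurable [set X : (n + n).-tuple (d.-tuple R) | selected rule kappa X j = k].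
Proof.
apply: measurable_sargmin_except => l m; rewrite /selection_score.
case: rule.
  by apply: measurable_fun_ler;
    exact: (@measurable_sample_mean R d n (n + n) (@rshift n n)).
(* Denominators are at least [kappa > 0], so cross-multiplying reduces the comparison of scores to
   one of products. *)
have E (a b u v : R) : (a / Num.max u kappa <= b / Num.max v kappa) =
    (a * Num.max v kappa <= b * Num.max u kappa).
  have max0 w : 0 < Num.max w kappa by rewrite lt_max kappa0 orbT.
  by rewrite ler_pdivrMr// mulrAC ler_pdivlMr.
under eq_fun do rewrite E.
have mm i : measurable_fun [set: (n + n).-tuple (d.-tuple R)]
    (fun X => sample_mean (half2 X) i 0).
  exact: (@measurable_sample_mean R d n (n + n) (@rshift n n)).
have mq i : measurable_fun [set: (n + n).-tuple (d.-tuple R)]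
    (fun X => Num.sqrt (quadv (sample_cov (half2 X)) (gamma R j i))).
  exact: (@measurable_sqrt_quadv R d n (n + n) (@rshift n n)).
apply: measurable_fun_ler; apply: measurable_funM.
- exact: measurable_funB.
- exact: measurable_maxr.
- exact: measurable_funB.
- exact: measurable_maxr.
Qed.

Lemma measurable_DA_test (j : 'I_d) :
  measurable [set X : (n + n).-tuple (d.-tuple R) | DA_test rule kappa alpha X j].
Proof.
(* Splitting by the value of the selected index leaves a comparison with a fixed contrast on each
   piece. *)
rewrite (_ : [set X | _] = \bigcup_(k in [set: 'I_d])
   ([set X : (n + n).-tuple (d.-tuple R) | selected rule kappa X j = k] `&`
    [set X | std_normal_quantile (1 - alpha) *
       Num.sqrt (quadv (sample_cov (half1 X)) (gamma R j k))
       < Num.sqrt n%:R * mean_contrast (half1 X) j k])).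
  apply: fin_bigcup_measurable => [|k _]; first exact: finite_finset.
  apply: measurableI; first exact: measurable_selected.
  rewrite -[X in measurable X]setTI.
  apply: (measurable_fun_ltr _ _ measurableT (Y := [set true])) => //.
    apply: measurable_funM => //.
    exact: (@measurable_sqrt_quadv R d n (n + n) (@lshift n n)).
  apply: measurable_funM => //.
  exact: (@measurable_mean_contrast R d n (n + n) (@lshift n n)).
apply/seteqP; split=> X /=.
  rewrite /DA_test/= dotv_gamma -mean_contrastE => H.
  by exists (selected rule kappa X j).
by move=> [k _ [/= <-]]; rewrite /DA_test/= dotv_gamma -mean_contrastE.
Qed.

End measurable_test.

(** * Tails of sample contrasts *)

Lemma measure_bigsetU_le (disp : measure_display) (T : measurableType disp)
    (R : realType) (mu : {measure set T -> \bar R}) (I : Type) (s : seq I)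
    (Q : pred I) (A : I -> set T) (p : I -> R) :
  (forall i, Q i -> measurable (A i)) ->
  (forall i, Q i -> (mu (A i) <= (p i)%:E)%E) ->
  (mu (\big[setU/set0]_(i <- s | Q i) A i) <= (\sum_(i <- s | Q i) p i)%:E)%E.
Proof.
move=> mA Ap; elim: s => [|i s IH]; first by rewrite !big_nil measure0.
rewrite !big_cons; case: ifPn => // Qi.
rewrite (le_trans (measureU2 _ _ _))//; first exact: mA.
  exact: bigsetU_measurable.
by rewrite EFinD leeD// Ap.
Qed.

Lemma min_meanP (R : realType) (d : nat) (mu : 'cV[R]_d) (r : 'I_d) :
  0 < mu r 0 - min_mean mu r ->
  exists2 ks, ks != r & mu ks 0 = min_mean mu r.
Proof.
move=> gap.
have minle k : min_mean mu r <= mu k 0 by exact: bigmin_le_cond.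
case: (@arg_minP _ _ _ r xpredT (fun k => mu k 0) isT) => ks _ ksmin.
have E : mu ks 0 = min_mean mu r.
  apply/eqP; rewrite eq_le minle andbT.
  by apply/bigmin_geP; split=> [|k _]; exact: ksmin.
exists ks => //; apply: contraTneq gap => ksr.
by rewrite -E ksr subrr ltxx.
Qed.

Section contrast_tails.
Context (R : realType) (d n : nat) (P : probability (d.-tuple R) R).
Variables (sigma : R) (r k : 'I_d) (delta : R).
Hypotheses (n1 : (1 < n)%N) (sigma0 : 0 < sigma).

Definition deviation (x : d.-tuple R) : R := tnth x r - tnth x k - delta.

Definition sample (y : n.-tuple (d.-tuple R)) i : 'cV[R]_d := colv (tnth y i).

Hypothesis mgfP : mgf_bounded P deviation sigma.

Lemma measurable_deviation : measurable_fun [set: d.-tuple R] deviation.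
Proof.
by apply: measurable_funB => //; apply: measurable_funB; exact: measurable_tnth.
Qed.

Lemma contrast_deviation y i :
  contrast (sample y) r k i - delta = deviation (tnth y i).
Proof. by rewrite /contrast !mxE. Qed.

Lemma mean_contrast_deviation y :
  n%:R * (mean_contrast (sample y) r k - delta) =
  \sum_i deviation (tnth y i).
Proof.
under [RHS]eq_bigr do rewrite -contrast_deviation.
rewrite sumrB sumr_const card_ord mulrBr -[delta *+ n]mulr_natl; congr (_ - _).
by rewrite /mean_contrast mulrA divff ?mul1r// pnatr_eq0 -lt0n ltnW.
Qed.

Let n0 : 0 < n%:R :> R. Proof. by rewrite ltr0n ltnW. Qed.

Lemma mean_contrast_ge (t : R) : 0 <= t ->
  (iid_law P n [set y | (t <= mean_contrast (sample y) r k - delta)%R]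
   <= (expR (- (n%:R * t ^+ 2 / (4 * sigma ^+ 2))))%:E)%E.
Proof.
move=> t0; have := iid_law_chernoff n measurable_deviation sigma0 t0 mgfP.
congr (_ <= _)%E; congr (iid_law P n _); apply/seteqP.
by split=> y /=; rewrite -mean_contrast_deviation ler_pM2l.
Qed.

Lemma mean_contrast_le (t : R) : 0 <= t ->
  (iid_law P n [set y | (mean_contrast (sample y) r k - delta <= - t)%R]
   <= (expR (- (n%:R * t ^+ 2 / (4 * sigma ^+ 2))))%:E)%E.
Proof.
move=> t0.
have mN : measurable_fun [set: d.-tuple R] (fun x => - deviation x).
  by apply: measurableT_comp => //; exact: measurable_deviation.
have := iid_law_chernoff n mN sigma0 t0 (mgf_boundedN mgfP).
congr (_ <= _)%E; congr (iid_law P n _); apply/seteqP.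
by split=> y /=; rewrite sumrN -mean_contrast_deviation lerNr -mulrN ler_pM2l.
Qed.

Lemma quadv_ge (t : R) : 0 < t ->
  (iid_law P n
     [set y | (t <= quadv (sample_cov (sample y)) (gamma R r k))%R]
   <= (16 * expR (sigma ^+ 2) / t)%:E)%E.
Proof.
move=> t0; have t20 : 0 < t / 2 by rewrite divr_gt0.
have := iid_law_sum_sqr (ltnW n1) measurable_deviation t20 mgfP.
rewrite (_ : 8 * _ / _ = 16 * expR (sigma ^+ 2) / t); last first.
  by field; rewrite lt0r_neq0.
apply: le_trans; apply: le_measure; rewrite ?inE.
- rewrite -[X in measurable X]setTI; apply: measurable_fun_le => //.
  exact: (@measurable_quadv R d n n id).
- rewrite -[X in measurable X]setTI; apply: measurable_fun_le => //.
  apply: measurable_sum => i; apply: measurable_funX.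
  by apply: measurableT_comp; [exact: measurable_deviation|exact: measurable_tnth].
move=> y /= ty; have := le_trans ty (quadv_sample_cov_le (sample y) r k delta n1).
have -> : \sum_i (contrast (sample y) r k i - delta) ^+ 2 =
    \sum_i deviation (tnth y i) ^+ 2.
  by apply: eq_bigr => i _; rewrite contrast_deviation.
set S := \sum_i _ => tS.
have -> : n%:R * (t / 2) = t * (n%:R / 2) by ring.
by rewrite -ler_pdivlMr ?divr_gt0// invf_div mulrC.
Qed.

(** Failure forces either the mean contrast below [delta / 2], which has a Chernoff tail, or a
    sample variance of order [n%:R * delta ^+ 2], which is controlled by Markov. *)
Lemma test_failure (z : R) : 0 < delta ->
  (iid_law P n
     [set y | (Num.sqrt n%:R * mean_contrast (sample y) r k <=
        z * Num.sqrt (quadv (sample_cov (sample y)) (gamma R r k)))%R]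
   <= (expR (- (n%:R * delta ^+ 2 / (16 * sigma ^+ 2))) +
       64 * expR (sigma ^+ 2) * (`|z| + 1) ^+ 2 / (n%:R * delta ^+ 2))%:E)%E.
Proof.
(* The quantile [z] can be zero or negative; [zeta] is a strictly positive upper bound by which one
   can divide. *)
move=> d0; set zeta := `|z| + 1.
have zeta0 : 0 < zeta by rewrite ltr_wpDl.
have zz : z <= zeta by rewrite (le_trans (ler_norm z))// lerDl.
have d20 : 0 <= delta / 2 by rewrite divr_ge0// ltW.
(* The variance at which [zeta * Num.sqrt t] equals [Num.sqrt n%:R * delta / 2]. *)
pose t := n%:R * delta ^+ 2 / (4 * zeta ^+ 2).
have t0 : 0 < t by rewrite divr_gt0// mulr_gt0// exprn_gt0.
have mm : measurable_fun [set: n.-tuple (d.-tuple R)]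
    (fun y => mean_contrast (sample y) r k).
  exact: (@measurable_mean_contrast R d n n id).
have mq : measurable_fun [set: n.-tuple (d.-tuple R)]
    (fun y => quadv (sample_cov (sample y)) (gamma R r k)).
  exact: (@measurable_quadv R d n n id).
have mq' : measurable_fun [set: n.-tuple (d.-tuple R)]
    (fun y => Num.sqrt (quadv (sample_cov (sample y)) (gamma R r k))).
  exact: (@measurable_sqrt_quadv R d n n id).
pose A := [set y | (mean_contrast (sample y) r k - delta <= - (delta / 2))%R].
pose B := [set y | (t <= quadv (sample_cov (sample y)) (gamma R r k))%R].
have mA : measurable A.
  rewrite -[X in measurable X]setTI; apply: measurable_fun_le => //.
  exact: measurable_funB.
have mB : measurable B.
  by rewrite -[X in measurable X]setTI; exact: measurable_fun_le.
apply: (@le_trans _ _ (iid_law P n (A `|` B))).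
  apply: le_measure; rewrite ?inE; last 1 first.
  - move=> y /=; rewrite -/t => Hy.
    have [Ay|nAy] := leP (mean_contrast (sample y) r k - delta) (- (delta / 2)).
      by left.
    right; rewrite /B/=.
    set q := quadv _ _ in Hy *; set m := mean_contrast _ _ _ in Hy nAy.
    have sn0 : 0 < Num.sqrt n%:R :> R by rewrite sqrtr_gt0.
    have q0 : 0 <= Num.sqrt q by exact: sqrtr_ge0.
    have H1 : Num.sqrt n%:R * (delta / 2) < zeta * Num.sqrt q.
      apply: (@lt_le_trans _ _ (Num.sqrt n%:R * m)).
        by rewrite ltr_pM2l//; lra.
      by rewrite (le_trans Hy)// ler_wpM2r.
    (* [Num.sqrt] is 0 on nonpositive reals, which would contradict [H1]; positivity then lets the
       square root be squared back to [q]. *)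
    have q_gt0 : 0 < q.
      rewrite ltNge; apply/negP => /ler0_sqrtr q00; move: H1.
      rewrite q00 mulr0; apply/negP; rewrite -leNgt mulr_ge0// ltW.
    rewrite /t ler_pdivrMr ?mulr_gt0 ?exprn_gt0//.
    have : (Num.sqrt n%:R * (delta / 2)) ^+ 2 <= (zeta * Num.sqrt q) ^+ 2.
      apply: lerXn2r (ltW H1); rewrite nnegrE; first exact: mulr_ge0 (ltW sn0) d20.
      exact: mulr_ge0 (ltW zeta0) q0.
    rewrite (_ : (zeta * _) ^+ 2 = zeta ^+ 2 * q); last first.
      by rewrite exprMn sqr_sqrtr// ltW.
    rewrite (_ : (_ * _) ^+ 2 = n%:R * delta ^+ 2 / 4); last first.
      by rewrite exprMn sqr_sqrtr ?ltW//; field.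
    rewrite ler_pdivrMr// => H2; apply: le_trans H2 _.
    by rewrite le_eqVlt; apply/orP; left; apply/eqP; ring.
  - rewrite -[X in measurable X]setTI; apply: measurable_fun_le => //.
      by apply: measurable_funM.
    by apply: measurable_funM.
  - exact: measurableU.
apply: (le_trans (measureU2 _ mA mB)).
rewrite EFinD; apply: leeD.
  have := mean_contrast_le d20.
  rewrite (_ : n%:R * (delta / 2) ^+ 2 / (4 * sigma ^+ 2) =
    n%:R * delta ^+ 2 / (16 * sigma ^+ 2))//.
  by field; rewrite lt0r_neq0.
have := quadv_ge t0.
rewrite (_ : 16 * _ / t = 64 * expR (sigma ^+ 2) * zeta ^+ 2 / (n%:R * delta ^+ 2))//.
by rewrite /t; field; rewrite !lt0r_neq0.
Qed.

End contrast_tails.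

(** As [k != r], the vector [gamma R r k] has norm [Num.sqrt 2]. Applying sub-Gaussianity to its
    normalization at [l * Num.sqrt 2] yields the exponent [l ^+ 2 * sigma ^+ 2]. *)
Lemma sub_gaussian_contrast (R : realType) (d : nat) (sigma : R)
    (P : probability (d.-tuple R) R) (r k : 'I_d) :
  sub_gaussian sigma P -> k != r ->
  mgf_bounded P (deviation r k (mean P r 0 - mean P k 0)) sigma.
Proof.
move=> [_ H] kr l.
have s0 : Num.sqrt 2 != 0 :> R by rewrite sqrtr_eq0 -ltNge.
have s2 : Num.sqrt 2 ^+ 2 = 2 :> R by rewrite sqr_sqrtr.
pose v := (Num.sqrt 2)^-1 *: gamma R r k.
have dv u : dotv v u = (Num.sqrt 2)^-1 * (u r 0 - u k 0).
  by rewrite -dotv_gamma /dotv /v linearZ/= -scalemxAl mxE.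
have vv : dotv v v = 1.
  rewrite dv /v !mxE !eqxx (negbTE kr) eq_sym (negbTE kr) /=.
  have -> : (Num.sqrt 2)^-1 * ((Num.sqrt 2)^-1 * (1%:R - 0%:R) -
     (Num.sqrt 2)^-1 * (0%:R - 1%:R)) = (Num.sqrt 2 ^+ 2)^-1 * 2 :> R by field.
  by rewrite s2 mulVf.
have := H (l * Num.sqrt 2) v vv; rewrite unlock.
rewrite exprMn s2 (_ : l ^+ 2 * 2 * _ / 2 = l ^+ 2 * sigma ^+ 2); last by field.
apply: le_trans; rewrite le_eqVlt; apply/orP; left; apply/eqP.
apply: eq_integral => x _; congr (expR _)%:E.
by rewrite dv !mxE /deviation; field.
Qed.

(** * Failure probability under an alternative *)

Section numeric.
Context (R : realType).
Implicit Types (x w : R).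

Lemma expRN_le_inv w x : 0 < w -> w <= x -> expR (- x) <= w^-1.
Proof.
move=> w0 wx; rewrite expRN lef_pV2 ?posrE ?expR_gt0//.
by rewrite (le_trans wx)// (le_trans _ (expR_ge1Dx x))// lerDr.
Qed.

(** With [L] the maximum, [tau <= expR L] (also at [tau = 0]), so the product is at most
    [expR (- (x - L))], and [x - L >= w * L >= w]. *)
Lemma confusion_term_le (tau : nat) w x : 0 < w ->
  (1 + w) * Num.max 1 (ln tau%:R) <= x -> tau%:R * expR (- x) <= w^-1.
Proof.
move=> w0; set L := Num.max _ _ => xL.
have L1 : 1 <= L by rewrite le_max lexx.
have tauL : tau%:R <= expR L.
  case: tau @L xL L1 => [|t] L xL L1; first exact: expR_ge0.
  by rewrite -{1}(@lnK _ t.+1%:R) ?posrE ?ltr0n// ler_expR le_max lexx orbT.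
apply: (@le_trans _ _ (expR L * expR (- x))).
  by rewrite ler_wpM2r ?expR_ge0.
rewrite -expRD -[L - x]opprK opprB; apply: expRN_le_inv => //.
nra.
Qed.

(** The left side is [expR (- ((b - 1) * ln d%:R))]. Since [ln d%:R >= ln 2], the requirement on [b]
    is uniform in the dimension. *)
Lemma far_term_le (d : nat) w b : (1 < d)%N -> 0 < w -> 1 + w / ln 2 <= b ->
  d%:R * expR (- (b * ln d%:R)) <= w^-1 :> R.
Proof.
move=> d1 w0 wb.
have d0 : 0 < d%:R :> R by rewrite ltr0n ltnW.
have l20 : 0 < ln 2 :> R by rewrite ln_gt0// ltr1n.
have l2d : ln 2 <= ln d%:R :> R by rewrite ler_ln ?posrE// ler_nat.
rewrite -{1}(@lnK _ d%:R) ?posrE// -expRD.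
rewrite -[_ - _]opprK opprB; apply: expRN_le_inv => //.
have : w <= (b - 1) * ln 2 by rewrite -ler_pdivrMr//; lra.
have : 0 < w / ln 2 by rewrite divr_gt0.
nra.
Qed.

End numeric.

Section halves.
Context (R : realType) (d n : nat).
Implicit Types x y : n.-tuple (d.-tuple R).

Lemma half1_cat x y : half1 [tuple of x ++ y] = sample x.
Proof. by apply/funext => i; rewrite /half1 tnth_lshift. Qed.

Lemma half2_cat x y : half2 [tuple of x ++ y] = sample y.
Proof. by apply/funext => i; rewrite /half2 tnth_rshift. Qed.

(** Once the second half is fixed, the selected index can therefore be treated as a constant. *)
Lemma selected_cat rule (kappa : R) x x' y (r : 'I_d) :
  selected rule kappa [tuple of x ++ y] r =
  selected rule kappa [tuple of x' ++ y] r.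
Proof.
have E k : selection_score rule kappa [tuple of x ++ y] r k =
    selection_score rule kappa [tuple of x' ++ y] r k.
  by rewrite /selection_score !half2_cat.
by rewrite /selected (funext E).
Qed.

End halves.

Section alternative.
Context (R : realType) (d n : nat) (rule : selection_rule).
Variables (kappa alpha sigma Cn M : R) (r : 'I_d).
Variable P : probability (d.-tuple R) R.
Hypotheses (n1 : (1 < n)%N) (d1 : (1 < d)%N).
Hypotheses (kappa0 : 0 < kappa) (sigma0 : 0 < sigma) (Cn0 : 0 < Cn).
Hypotheses (kM : kappa <= M) (M1 : 1 <= M).
Hypothesis sgP : sub_gaussian sigma P.

Variables (mu : 'cV[R]_d) (muE : mean P = mu).
Variables gap c L : R.
Hypotheses (gapE : mu r 0 - min_mean mu r = gap) (gap0 : 0 < gap).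
Hypothesis cE : c = Num.min kappa 1 / (4 * M).
Hypothesis LE : L = Cn * Num.sqrt (ln d%:R / n%:R).

Let conf := confusion_set Cn n mu r.

Let M0 : 0 < M. Proof. exact: lt_le_trans M1. Qed.

Let c0 : 0 < c.
Proof. by rewrite cE divr_gt0 ?mulr_gt0// lt_min kappa0/=. Qed.

Let c14 : c <= 4^-1.
Proof.
rewrite cE ler_pdivrMr ?mulr_gt0// mulrA mulVf// mul1r.
by rewrite (le_trans _ M1)// ge_min lexx orbT.
Qed.

Let n0 : 0 < n%:R :> R. Proof. by rewrite ltr0n ltnW. Qed.

Let L0 : 0 <= L.
Proof. by rewrite LE mulr_ge0 ?sqrtr_ge0// ltW. Qed.

Let mdev k : k != r -> mgf_bounded P (deviation r k (mu r 0 - mu k 0)) sigma.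
Proof. by rewrite -muE; exact: sub_gaussian_contrast. Qed.

(** As [c <= 1 / 4], the mean of [k] exceeds the minimum by at least [gap / 2]. So [k] is no
    minimizer and meets the lower bound of the confusion set; only the upper bound can fail. *)
Lemma far_or_confused k : k != r -> mu r 0 - mu k 0 <= c * gap ->
  k \notin conf -> L < mu k 0 - min_mean mu r.
Proof.
move=> kr kc; rewrite inE kr/= negb_and negbK.
have [ks ksr ksE] : exists2 ks, ks != r & mu ks 0 = min_mean mu r.
  by apply: min_meanP; rewrite gapE.
have gapk : gap / 2 <= mu k 0 - min_mean mu r.
  have : c * gap <= 4^-1 * gap by rewrite ler_pM2r.
  have -> : min_mean mu r = mu r 0 - gap by rewrite -gapE; ring.
  by move: kc gap0; move: (mu r 0) (mu k 0) => a b; lra.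
rewrite (_ : (k \in _) = false) /=; last first.
  apply/negbTE; rewrite inE kr/=; apply/negP => /forallP/(_ ks).
  rewrite ksr/= ksE; apply/negP; rewrite -ltNge.
  by rewrite -subr_gt0 (lt_le_trans _ gapk)// divr_gt0.
by rewrite gapE gapk/= -ltNge LE.
Qed.

Let p k : R := if k \in conf then expR (- (n%:R * (c * gap) ^+ 2 / (4 * sigma ^+ 2)))
  else expR (- (n%:R * (c * L / 2) ^+ 2 / (4 * sigma ^+ 2))).

Lemma wrong_index_le k : k != r -> mu r 0 - mu k 0 <= c * gap ->
  (iid_law P n [set y | (2 * c * gap <= mean_contrast (sample y) r k)%R]
   <= (p k)%:E)%E.
Proof.
move=> kr kc; set delta := mu r 0 - mu k 0 in kc *.
have cgap0 : 0 < c * gap by rewrite mulr_gt0.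
have t0 : 0 <= 2 * c * gap - delta by lra.
rewrite (_ : [set y | _] = [set y |
  (2 * c * gap - delta <= mean_contrast (sample y) r k - delta)%R]); last first.
  by apply/seteqP; split=> y /=; rewrite lerD2r.
apply: le_trans (mean_contrast_ge n1 sigma0 (mdev kr) t0) _.
have mono (a : R) : 0 <= a -> a <= 2 * c * gap - delta ->
  expR (- (n%:R * (2 * c * gap - delta) ^+ 2 / (4 * sigma ^+ 2))) <=
  expR (- (n%:R * a ^+ 2 / (4 * sigma ^+ 2))).
  move=> a0 at_; rewrite ler_expR lerN2 ler_pM2r ?invr_gt0 ?mulr_gt0 ?exprn_gt0//.
  by rewrite ler_pM2l// lerXn2r ?nnegrE.
rewrite lee_fin /p; case: ifPn => kconf; apply: mono.
- exact: ltW.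
- lra.
- by rewrite divr_ge0// mulr_ge0// ltW.
have far := far_or_confused kr kc kconf.
have cL : c * L <= 4^-1 * L by rewrite ler_wpM2r.
have kE : mu k 0 - min_mean mu r = gap - delta by rewrite -gapE /delta; ring.
rewrite kE in far.
(* The required deviation is [2 * c * gap - delta]. If [gap >= L / 2], it is at least
   [c * gap >= c * L / 2]; otherwise [delta < gap - L < - L / 2], and [- delta] alone exceeds
   [c * L / 2]. *)
have [Lg|gL] := leP (L / 2) gap.
  have : c * (L / 2) <= c * gap by rewrite ler_pM2l.
  lra.
lra.
Qed.

Let sum_p : \sum_(k | (k != r) && (mu r 0 - mu k 0 <= c * gap)) p k <=
  #|conf|%:R * expR (- (n%:R * (c * gap) ^+ 2 / (4 * sigma ^+ 2))) +
  d%:R * expR (- (n%:R * (c * L / 2) ^+ 2 / (4 * sigma ^+ 2))).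
Proof.
set a := expR _; set b := expR _.
have a0 : 0 <= a by exact: expR_ge0.
have b0 : 0 <= b by exact: expR_ge0.
rewrite (_ : #|conf|%:R * a = \sum_k (if k \in conf then a else 0)); last first.
  by rewrite -big_mkcond/= sumr_const mulr_natl.
rewrite (_ : d%:R * b = \sum_(k < d) b); last first.
  by rewrite sumr_const card_ord mulr_natl.
rewrite -big_split/= big_mkcond/=; apply: ler_sum => k _.
rewrite /p; case: ifPn => _; case: ifPn => _; rewrite ?addr0 ?add0r ?lerDl//.
exact: addr_ge0.
Qed.

Lemma test_failure_bound :
  (iid_law P (n + n) [set X | ~~ DA_test rule kappa alpha X r] <=
   (expR (- (n%:R * gap ^+ 2 / (16 * sigma ^+ 2))) +
    16 * expR (sigma ^+ 2) / M ^+ 2 +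
    (#|conf|%:R * expR (- (n%:R * (c * gap) ^+ 2 / (4 * sigma ^+ 2))) +
     d%:R * expR (- (n%:R * (c * L / 2) ^+ 2 / (4 * sigma ^+ 2)))) +
    (expR (- (n%:R * (c * gap) ^+ 2 / (16 * sigma ^+ 2))) +
     64 * expR (sigma ^+ 2) * (`|std_normal_quantile (1 - alpha)| + 1) ^+ 2 /
      (n%:R * (c * gap) ^+ 2)))%:E)%E.
Proof.
have [ks ksr ksE] : exists2 ks, ks != r & mu ks 0 = min_mean mu r.
  by apply: min_meanP; rewrite gapE.
have ksgap : mu r 0 - mu ks 0 = gap by rewrite ksE.
set z := std_normal_quantile (1 - alpha).
have mm k : measurable_fun [set: n.-tuple (d.-tuple R)]
    (fun y => mean_contrast (sample y) r k).
  exact: (@measurable_mean_contrast R d n n id).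
have mq k : measurable_fun [set: n.-tuple (d.-tuple R)]
    (fun y => quadv (sample_cov (sample y)) (gamma R r k)).
  exact: (@measurable_quadv R d n n id).
(* Bad events for the second half: the contrast of [ks] is too small ([B1]), its variance too large
   ([B2]), or an index of small population contrast reaches the level [2 * c * gap] ([U3]). *)
pose B1 := [set y : n.-tuple (d.-tuple R) |
  (mean_contrast (sample y) r ks - gap <= - (gap / 2))%R].
pose B2 := [set y : n.-tuple (d.-tuple R) |
  (M ^+ 2 <= quadv (sample_cov (sample y)) (gamma R r ks))%R].
pose B3 k := [set y : n.-tuple (d.-tuple R) |
  (2 * c * gap <= mean_contrast (sample y) r k)%R].
pose Q k := (k != r) && (mu r 0 - mu k 0 <= c * gap).
pose U3 := \big[setU/set0]_(k < d | Q k) B3 k.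
have mB1 : measurable B1.
  rewrite -[X in measurable X]setTI; apply: measurable_fun_le => //.
  exact: measurable_funB.
have mB2 : measurable B2.
  by rewrite -[X in measurable X]setTI; exact: measurable_fun_le.
have mB3 k : measurable (B3 k).
  by rewrite -[X in measurable X]setTI; exact: measurable_fun_le.
have mU3 : measurable U3 by exact: bigsetU_measurable.
have mB12 : measurable (B1 `|` B2) by exact: measurableU.
have mB : measurable (B1 `|` B2 `|` U3) by exact: measurableU.
have M20 : 0 < M ^+ 2 by rewrite exprn_gt0.
have cgap0 : 0 < c * gap by rewrite mulr_gt0.
have mE : measurable [set X : (n + n).-tuple (d.-tuple R) |
    ~~ DA_test rule kappa alpha X r].
  have := measurableC (@measurable_DA_test R d n rule kappa alpha kappa0 r).
  by congr measurable; apply/seteqP; split=> X /= /negP.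
set F := expR (- (n%:R * (c * gap) ^+ 2 / (16 * sigma ^+ 2))) + _.
have F0 : 0 <= F.
  rewrite addr_ge0 ?expR_ge0//; apply: divr_ge0.
    exact: mulr_ge0 (mulr_ge0 _ (expR_ge0 _)) (sqr_ge0 _).
  exact: mulr_ge0 (ltW n0) (sqr_ge0 _).
have step (y : n.-tuple (d.-tuple R)) : ~ (B1 `|` B2 `|` U3) y ->
   (iid_law P n [set x : n.-tuple (d.-tuple R) |
      ~~ DA_test rule kappa alpha [tuple of x ++ y] r] <= F%:E)%E.
  move=> /not_orP[/not_orP[nB1 nB2] nU3].
  (* The first copy of [y] is a placeholder, since selection ignores the first half. *)
  pose s := selected rule kappa [tuple of y ++ y] r.
  have selE (x : n.-tuple (d.-tuple R)) :
      selected rule kappa [tuple of x ++ y] r = s.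
    exact: selected_cat.
  have [sr _] := sargmin_exceptP r (selection_score rule kappa [tuple of y ++ y] r) d1.
  rewrite -/(selected _ _ _ _) -/s in sr.
  have mcs : 2 * c * gap <= mean_contrast (sample y) r s.
    rewrite (_ : 2 * c = Num.min kappa 1 / (2 * M)); last first.
      by rewrite cE; field; rewrite lt0r_neq0.
    rewrite -(half2_cat y y); apply: selected_mean_contrast ksr _ _ => //.
    - rewrite half2_cat; have /negP := nB1; rewrite -ltNge; lra.
    - by rewrite half2_cat; have /negP := nB2; rewrite -ltNge => /ltW.
  set delta := mu r 0 - mu s 0.
  (* Otherwise [s] would be one of the indices of [U3], by [mcs]. *)
  have cdelta : c * gap < delta.
    rewrite ltNge; apply/negP => ds; apply: nU3.
    by rewrite /U3 -bigcup_seq_cond; exists s => //=; rewrite mem_index_enum/= /Q sr.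
  have delta0 : 0 < delta by exact: lt_trans cdelta.
  rewrite (_ : [set x | _] = [set x | (Num.sqrt n%:R * mean_contrast (sample x) r s
      <= z * Num.sqrt (quadv (sample_cov (sample x)) (gamma R r s)))%R]); last first.
    apply/seteqP; split=> x /=;
      by rewrite /DA_test selE half1_cat -leNgt dotv_gamma -mean_contrastE.
  apply: le_trans (test_failure n1 sigma0 (mdev sr) z delta0) _.
  (* The failure bound decreases in [delta], so [delta] may be replaced by [c * gap], which does not
     depend on the selected index. *)
  have d2 : n%:R * (c * gap) ^+ 2 <= n%:R * delta ^+ 2.
    by rewrite ler_pM2l// lerXn2r ?nnegrE// ltW.
  have e0 : 0 < n%:R * (c * gap) ^+ 2 by rewrite mulr_gt0// exprn_gt0.
  rewrite lee_fin lerD//.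
    by rewrite ler_expR lerN2 ler_pM2r// invr_gt0 mulr_gt0// exprn_gt0.
  rewrite ler_wpM2l ?mulr_ge0 ?expR_ge0 ?sqr_ge0//.
  by rewrite lef_pV2// posrE// (lt_le_trans e0).
have := @iid_law_cat_le _ _ _ P n n _ _ F mE mB F0 step.
move/le_trans; apply; rewrite [leRHS]EFinD; apply: leeD => //.
apply: le_trans (measureU2 _ mB12 mU3) _; rewrite EFinD; apply: leeD.
  apply: le_trans (measureU2 _ mB1 mB2) _; rewrite EFinD; apply: leeD.
    have g20 : 0 <= gap / 2 by rewrite divr_ge0// ltW.
    have := mdev ksr; rewrite ksgap => dks.
    have := mean_contrast_le n1 sigma0 dks g20.
    rewrite (_ : n%:R * (gap / 2) ^+ 2 / _ = n%:R * gap ^+ 2 / (16 * sigma ^+ 2))//.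
    by field; rewrite lt0r_neq0.
  exact: (quadv_ge n1 (mdev ksr) M20).
apply: le_trans (measure_bigsetU_le _ _ _) _ => //.
  by move=> k /andP[kr kc]; exact: wrong_index_le.
by rewrite lee_fin.
Qed.

End alternative.

(** * Uniform failure bound over the class of alternatives *)

Section alternatives_failure.
Context (R : realType) (d n tau : nat) (rule : selection_rule).
Variables (kappa alpha sigma Cn C'n eps M w c : R) (r : 'I_d).
Variable P : probability (d.-tuple R) R.
Hypotheses (n1 : (1 < n)%N) (d1 : (1 < d)%N).
Hypotheses (kappa0 : 0 < kappa) (sigma0 : 0 < sigma).
Hypotheses (Cn0 : 0 < Cn) (C'n0 : 0 < C'n) (w0 : 0 < w).
Hypotheses (kM : kappa <= M) (M1 : 1 <= M).
Hypothesis cE : c = Num.min kappa 1 / (4 * M).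
Hypothesis wM : 16 * expR (sigma ^+ 2) * w <= M ^+ 2.
Hypothesis C'n_large : 16 * sigma ^+ 2 * (1 + w) +
  64 * expR (sigma ^+ 2) * (`|std_normal_quantile (1 - alpha)| + 1) ^+ 2 * w
  <= (c * C'n) ^+ 2.
Hypothesis Cn_large : 16 * sigma ^+ 2 * (1 + w / ln 2) <= (c * Cn) ^+ 2.
Hypothesis eps_large : C'n * eps_star tau n <= eps.
Hypothesis altP : alternatives sigma Cn n r eps tau P.

(** The failure bound has six summands, each made at most [w^-1]: [wM] handles the variance of [ks],
    [Cn_large] the far indices, and [C'n_large] the four terms driven by the gap. *)
Lemma alternatives_failure_le :
  (iid_law P (n + n) [set X | ~~ DA_test rule kappa alpha X r]
   <= (6 / w)%:E)%E.
Proof.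
have [sgP epsgap cardconf] := altP.
set gap := mean P r 0 - _ in epsgap.
pose T := Num.max 1 (ln tau%:R) : R.
have T1 : 1 <= T by rewrite le_max lexx.
have n0 : 0 < n%:R :> R by rewrite ltr0n ltnW.
have s20 : 0 < sigma ^+ 2 by rewrite exprn_gt0.
have Tn0 : 0 < T / n%:R by rewrite divr_gt0// (lt_le_trans _ T1).
have g1 : C'n * Num.sqrt (T / n%:R) <= gap by exact: le_trans eps_large epsgap.
have g2 : 0 < C'n * Num.sqrt (T / n%:R) by rewrite mulr_gt0// sqrtr_gt0.
have gap0 : 0 < gap by exact: lt_le_trans g1.
have M0 : 0 < M by exact: lt_le_trans M1.
have m0 : 0 < Num.min kappa 1 by rewrite lt_min kappa0 ltr01.
have c0 : 0 < c by rewrite cE divr_gt0// mulr_gt0.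
have c1 : c <= 1.
  rewrite cE ler_pdivrMr ?mulr_gt0// mul1r.
  apply: (@le_trans _ _ 1); first by rewrite ge_min lexx orbT.
  by rewrite (le_trans M1)// ler_peMl ?(ltW M0)// ler1n.
have gapT : C'n ^+ 2 * T <= n%:R * gap ^+ 2.
  have : (C'n * Num.sqrt (T / n%:R)) ^+ 2 <= gap ^+ 2.
    by rewrite lerXn2r ?nnegrE// ltW.
  rewrite exprMn (sqr_sqrtr (ltW Tn0)) mulrA ler_pdivrMr//.
  by rewrite [gap ^+ 2 * _]mulrC.
(* The squared signal strength; the scaling of [eps_star] cancels [n] and leaves
   [V >= (c * C'n) ^+ 2 * T]. *)
pose V := n%:R * (c * gap) ^+ 2.
have VT : (c * C'n) ^+ 2 * T <= V.
  have -> : V = c ^+ 2 * (n%:R * gap ^+ 2) by rewrite /V; ring.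
  by rewrite exprMn -mulrA ler_pM2l// exprn_gt0.
pose K := 64 * expR (sigma ^+ 2) * (`|std_normal_quantile (1 - alpha)| + 1) ^+ 2.
have K0 : 0 <= K by rewrite mulr_ge0 ?sqr_ge0// mulr_ge0 ?expR_ge0.
have w10 : 0 <= 1 + w by exact: addr_ge0 (ltW w0).
have sw0 : 0 <= 16 * sigma ^+ 2 * (1 + w).
  exact: mulr_ge0 (mulr_ge0 _ (ltW s20)) w10.
have V1 : 16 * sigma ^+ 2 * (1 + w) * T <= V.
  apply: le_trans VT; rewrite ler_pM2r ?(lt_le_trans _ T1)//.
  by apply: le_trans C'n_large; rewrite lerDl mulr_ge0 ?(ltW w0).
have V2 : K * w <= V.
  apply: (@le_trans _ _ ((c * C'n) ^+ 2)).
    by apply: le_trans C'n_large; rewrite lerDr.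
  by apply: le_trans VT; rewrite ler_peMr ?sqr_ge0.
have V3 : 16 * sigma ^+ 2 * (1 + w) <= V.
  by apply: le_trans V1; rewrite ler_peMr.
have V0 : 0 < V by rewrite mulr_gt0// exprn_gt0// mulr_gt0.
pose L := Cn * Num.sqrt (ln d%:R / n%:R).
have := @test_failure_bound R d n rule kappa alpha sigma Cn M r P n1 d1 kappa0
  sigma0 Cn0 kM M1 sgP (mean P) erefl gap c L erefl gap0 cE erefl.
move/le_trans; apply; rewrite lee_fin cardconf -/V -/K.
have -> : 6 / w = w^-1 + w^-1 + (w^-1 + w^-1) + (w^-1 + w^-1) by ring.
have V16 : w <= V / (16 * sigma ^+ 2).
  rewrite ler_pdivlMr ?mulr_gt0//; apply: le_trans V3.
  by rewrite mulrC ler_pM2l ?mulr_gt0// lerDr.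
rewrite !lerD//.
- apply: expRN_le_inv => //; apply: le_trans V16 _.
  rewrite ler_pM2r ?invr_gt0 ?mulr_gt0// /V ler_pM2l// exprMn.
  by rewrite ler_piMl ?sqr_ge0// expr_le1// ltW.
- by rewrite ler_pdivrMr ?exprn_gt0// ler_pdivlMl// mulrC.
- apply: confusion_term_le => //; rewrite ler_pdivlMr ?mulr_gt0//.
  apply: le_trans V1; rewrite -/T.
  have : 0 <= sigma ^+ 2 * ((1 + w) * T).
    exact: mulr_ge0 (ltW s20) (mulr_ge0 w10 (le_trans ler01 T1)).
  move=> H; rewrite -subr_ge0.
  rewrite (_ : _ - _ = 12 * (sigma ^+ 2 * ((1 + w) * T))); last by ring.
  exact: mulr_ge0.
- have l0 : 0 <= ln d%:R :> R by rewrite ln_ge0// ler1n ltnW.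
  (* The radius of the confusion set carries [ln d%:R / n%:R], so [n] cancels and the exponent is a
     multiple of [ln d%:R], large enough to beat the factor [d]. *)
  rewrite (_ : n%:R * (c * L / 2) ^+ 2 / (4 * sigma ^+ 2) =
     (c * Cn) ^+ 2 / (16 * sigma ^+ 2) * ln d%:R); last first.
    have -> : (c * L / 2) ^+ 2 = (c * Cn / 2) ^+ 2 * (ln d%:R / n%:R).
      rewrite -[in RHS](sqr_sqrtr (_ : 0 <= ln d%:R / n%:R)) ?divr_ge0// ?(ltW n0)//.
      by rewrite /L; ring.
    by field; rewrite !lt0r_neq0.
  apply: far_term_le => //.
  by rewrite ler_pdivlMr ?mulr_gt0// mulrC.
- exact: expRN_le_inv.
- by rewrite ler_pdivrMr// ler_pdivlMl// mulrC.
Qed.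

End alternatives_failure.

(** * Passage to the limit *)

Lemma DA_test_setC (R : realType) (d n : nat) (rule : selection_rule)
    (kappa alpha : R) (r : 'I_d) :
  [set X : (n + n).-tuple (d.-tuple R) |
    r \notin DA_confidence_set rule kappa alpha X] =
  ~` [set X | ~~ DA_test rule kappa alpha X r].
Proof.
apply/seteqP; split=> X /=; rewrite inE negbK; first by move=> ->.
by move=> /negP; rewrite negbK.
Qed.

Lemma cvge_to1 (R : realType) (u : nat -> \bar R) :
  (forall n, (u n <= 1)%E) ->
  (forall e : R, 0 < e -> \forall n \near \oo, ((1 - e)%:E <= u n)%E) ->
  u n @[n --> \oo] --> 1%E.
Proof.
move=> u1 ue; apply/fine_cvgP.
have ufin n (x : R) : (x%:E <= u n)%E -> u n \is a fin_num.
  move=> xu; rewrite fin_numE -ltNye -ltey (lt_le_trans _ xu) ?ltNyr//=.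
  by rewrite (le_lt_trans (u1 n))// ltry.
(* The tolerance 1 gives the lower bound 0, hence eventual finiteness. *)
split; first by apply: filterS (ue 1 ltr01) => n; exact: ufin.
apply/cvgrPdist_le => e e0; apply: filterS (ue e e0) => n une /=.
have un := ufin _ _ une.
move: (u1 n) une; rewrite -(fineK un) !lee_fin => h1 h2.
by rewrite ger0_norm; lra.
Qed.

Theorem corollary3p2 (R : realType) (rule : selection_rule)
    (alpha sigma kappa : R) (C C' eps : nat -> R) (d tau : nat -> nat)
    (r : forall n : nat, 'I_(d n)) :
  0 < alpha < 1 -> 0 < sigma -> 0 < kappa ->
  (forall n, 0 < C n) -> C n @[n --> \oo] --> +oo ->
  (forall n, 0 < C' n) -> C' n @[n --> \oo] --> +oo ->
  (forall n, 2 <= d n)%N ->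
  (forall n, tau n <= d n - 2)%N ->
  (forall n, C' n * eps_star (tau n) n <= eps n) ->
  prob_inf [set iid_law P (n + n)%N
                  [set X | r n \notin DA_confidence_set rule kappa alpha X]
            | P in alternatives sigma (C n) n (r n) (eps n) (tau n)]
    @[n --> \oo] --> 1%E.
Proof.
move=> _ sigma0 kappa0 C0 Coo C'0 C'oo d2 _ epsC'.
have mfail n : measurable [set X : (n + n).-tuple ((d n).-tuple R) |
    ~~ DA_test rule kappa alpha X (r n)].
  have := measurableC (@measurable_DA_test R (d n) n rule kappa alpha kappa0 (r n)).
  by congr measurable; apply/seteqP; split=> X /= /negP.
apply: cvge_to1 => [n|e e0].
  rewrite /prob_inf; case: ifPn => // /set0P[_ [P altP _]].
  apply: ge_ereal_inf; exists (iid_law P (n + n)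
    [set X | r n \notin DA_confidence_set rule kappa alpha X]).
    by exists P.
  rewrite DA_test_setC; apply: probability_le1; exact: measurableC (mfail n).
(* Six terms of size [w^-1] then add up to [e]. *)
pose w := 6 / e.
have w0 : 0 < w by rewrite divr_gt0.
have ew : 6 / w = e by rewrite /w; field; rewrite lt0r_neq0.
have sq0 : 0 <= sigma ^+ 2 by exact: sqr_ge0.
pose K := 16 * expR (sigma ^+ 2) * w.
have K0 : 0 <= K by exact: mulr_ge0 (mulr_ge0 _ (expR_ge0 _)) (ltW w0).
(* [M] dominates [kappa], 1 and [K], and [M ^+ 2 >= M] as [M >= 1]. Neither [M] nor [c] depends on
   [n] or [P], which makes the bound uniform over the class. *)
pose M := 1 + kappa + K.
have kM : kappa <= M by rewrite /M; lra.
have M1 : 1 <= M by rewrite /M; lra.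
have wM : K <= M ^+ 2.
  apply: (@le_trans _ _ M); first by rewrite /M; lra.
  by rewrite expr2 ler_peMr//; lra.
pose c := Num.min kappa 1 / (4 * M).
have c0 : 0 < c.
  by rewrite divr_gt0 ?lt_min ?kappa0 ?ltr01// mulr_gt0//; lra.
pose Q1 := 16 * sigma ^+ 2 * (1 + w) +
  64 * expR (sigma ^+ 2) * (`|std_normal_quantile (1 - alpha)| + 1) ^+ 2 * w.
pose Q2 := 16 * sigma ^+ 2 * (1 + w / ln 2).
(* The added 1 ensures [c * a >= 1], so that squaring does not decrease it. *)
have large (q a : R) : (`|q| + 1) / c <= a -> q <= (c * a) ^+ 2.
  rewrite ler_pdivrMr// mulrC => qa; apply: (@le_trans _ _ (c * a)).
    by rewrite (le_trans (ler_norm q))// (le_trans _ qa)// lerDl.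
  by rewrite expr2 ler_peMr// ?(le_trans _ qa)// ?lerDr// addr_ge0.
have hC' : \forall n \near \oo, (`|Q1| + 1) / c <= C' n.
  by move/cvgryPge : C'oo; exact.
have hC : \forall n \near \oo, (`|Q2| + 1) / c <= C n.
  by move/cvgryPge : Coo; exact.
near=> n.
rewrite /prob_inf; case: ifPn => [_|_]; first by rewrite lee_fin gerBl ltW.
apply: le_ereal_inf_tmp => _ [P altP <-].
rewrite DA_test_setC probability_setC; last exact: mfail.
rewrite EFinB leeB// -ew.
apply: (@alternatives_failure_le R (d n) n (tau n) rule kappa alpha sigma (C n)
  (C' n) (eps n) M w c (r n) P) => //.
- by near: n; exact: nbhs_infty_gt.
- apply: large; near: n; exact: hC'.
- apply: large; near: n; exact: hC.
Unshelve. all: by end_near.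
Qed.
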